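(* Let $B$ and $B_0$ be symmetric nonnegative $k\times k$ matrices. Then $\delta_p(B,B_0)\le k^4\,\delta_{\mathrm{ds}}(B,B_0)$.
   Context: $\delta_p(B,B_0)=\frac1{k^2}\min_{\pi}\sum_{i,j\in[k]}(B(\pi(i),\pi(j))-B_0(i,j))^2$, the minimum over permutations $\pi$ of $[k]$. $\delta_{\mathrm{ds}}(B,B_0)=\min_{S}\frac1{k^2}\sum_{a,a',b,b'\in[k]}(B(a,b)-B_0(a',b'))^2S(a,a')S(b,b')$, the minimum over $k\times k$ doubly stochastic matrices $S$. *)

(* Defs.v *)
From mathcomp Require Import all_boot all_order all_algebra all_fingroup.
From mathcomp Require Import all_classical all_reals all_analysis.

Set Implicit Arguments.
Unset Strict Implicit.
Unset Printing Implicit Defensive.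

Import Order.TTheory GRing.Theory Num.Theory.
Import numFieldNormedType.Exports.
Local Open Scope classical_set_scope.
Local Open Scope ring_scope.

Section Distances.
Variables (R : realType) (k : nat).

Definition perm_cost (B B0 : 'M[R]_k) (s : 'S_k) : R :=
  (k%:R ^+ 2)^-1 * \sum_(i < k) \sum_(j < k) (B (s i) (s j) - B0 i j) ^+ 2.

Definition delta_p (B B0 : 'M[R]_k) : R :=
  perm_cost B B0 [arg min_(s < 1%g : 'S_k) perm_cost B B0 s]%O.

Definition doubly_stochastic (S : 'M[R]_k) : Prop :=
  [/\ forall a b, 0 <= S a b,
      forall a, \sum_(b < k) S a b = 1
    & forall b, \sum_(a < k) S a b = 1].

Definition ds_cost (B B0 S : 'M[R]_k) : R :=
  (k%:R ^+ 2)^-1 *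
  \sum_(a < k) \sum_(a' < k) \sum_(b < k) \sum_(b' < k)
    (B a b - B0 a' b') ^+ 2 * S a a' * S b b'.

(* The infimum is a minimum, by compactness of the set of doubly stochastic
   matrices: see delta_ds_min below. *)
Definition delta_ds (B B0 : 'M[R]_k) : R :=
  inf [set ds_cost B B0 S | S in doubly_stochastic].

Lemma delta_p_min (B B0 : 'M[R]_k) :
  (exists s, delta_p B B0 = perm_cost B B0 s) /\
  (forall s, delta_p B B0 <= perm_cost B B0 s).
Proof.
rewrite /delta_p; case: arg_minP => // s _ smin; split; first by exists s.
by move=> t; apply: smin.
Qed.

Lemma sum_continuous_fun (T : topologicalType) (I : finType)
    (f : I -> T -> R) :
  (forall i, continuous (f i)) -> continuous (fun x => \sum_i f i x).
Proof.
move=> fc x.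
by apply: cvg_big => [|i _]; [exact: add_continuous|exact: fc].
Qed.

Lemma delta_ds_min (B B0 : 'M[R]_k) :
  (exists2 S, doubly_stochastic S & delta_ds B B0 = ds_cost B B0 S) /\
  (forall S, doubly_stochastic S -> delta_ds B B0 <= ds_cost B B0 S).
Proof.
have ds1 : doubly_stochastic (1%:M : 'M[R]_k).
  split=> [a b|a|b]; first by rewrite mxE ler0n.
    rewrite (bigD1 a) //= mxE eqxx big1 ?addr0// => b /negPf ba.
    by rewrite mxE eq_sym ba.
  rewrite (bigD1 b) //= mxE eqxx big1 ?addr0// => a /negPf ab.
  by rewrite mxE ab.
pose K := [set v : 'rV[R]_(k * k) | doubly_stochastic (vec_mx v)].
have entry_cts a b : continuous (fun v : 'rV[R]_(k * k) => vec_mx v a b).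
  under eq_fun do rewrite mxE.
  exact: coord_continuous.
have cts : continuous (fun v : 'rV[R]_(k * k) => ds_cost B B0 (vec_mx v)).
  have ctsM (f g : 'rV[R]_(k * k) -> R) : continuous f -> continuous g ->
      continuous (fun v => f v * g v).
    by move=> fc gc v; apply: (@continuousM R _ f g); [exact: fc|exact: gc].
  rewrite /ds_cost; apply: (ctsM); first by move=> v; exact: cst_continuous.
  do 4!apply: sum_continuous_fun => ?.
  apply: (ctsM); last exact: entry_cts.
  by apply: (ctsM); [move=> v; exact: cst_continuous|exact: entry_cts].
have Kclosed : closed K.
  rewrite (_ : K = (\bigcap_(p in [set: 'I_k * 'I_k])
      [set v | 0 <= vec_mx v p.1 p.2]) `&`
      ((\bigcap_(a in [set: 'I_k]) [set v | \sum_b vec_mx v a b = 1]) `&`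
       (\bigcap_(b in [set: 'I_k]) [set v | \sum_a vec_mx v a b = 1]))); last first.
    apply/seteqP; split=> v.
      by case=> v0 vr vc; split=> [[a b] _|]; [exact: v0|split=> a _ /=].
    case=> v0 [vr vc]; split=> [a b|a|b].
    - exact: (v0 (a, b)).
    - exact: vr.
    - exact: vc.
  apply: closedI; last apply: closedI; apply: closed_bigI => p _.
  - by apply: (@preimage_closed _ _ _ [set x : R | 0 <= x]);
      [move=> *; exact: entry_cts|exact: closed_ge].
  - by apply: (@preimage_closed _ _ _ [set x : R | x = 1]);
      [move=> *; apply: sum_continuous_fun => b; exact: entry_cts
      |exact: closed_eq].
  - by apply: (@preimage_closed _ _ _ [set x : R | x = 1]);
      [move=> *; apply: sum_continuous_fun => b; exact: entry_cts
      |exact: closed_eq].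
have Kcompact : compact K.
  apply: (subclosed_compact Kclosed
    (@rV_compact R _ (fun=> `[0, 1]%classic) _)).
    by move=> _; exact: segment_compact.
  move=> v [v0 vr _] i /=; rewrite in_itv /=.
  have -> : v ord0 i = vec_mx v (enum_val (cast_ord (esym (mxvec_cast k k)) i)).1
     (enum_val (cast_ord (esym (mxvec_cast k k)) i)).2.
    by case/mxvec_indexP: i => a b; rewrite mxE /mxvec_index cast_ordK enum_rankK.
  rewrite v0 /= -(vr (enum_val (cast_ord (esym (mxvec_cast k k)) i)).1).
  by rewrite [leRHS](bigD1 (enum_val (cast_ord (esym (mxvec_cast k k)) i)).2) //= lerDl sumr_ge0.
have [|v /set_mem Kv vmin] := compact_EVT_min _ Kcompact (continuous_subspaceT cts).
  by exists (mxvec 1%:M); rewrite /K /= mxvecK.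
have vlb : lbound [set ds_cost B B0 S | S in doubly_stochastic]
    (ds_cost B B0 (vec_mx v)).
  move=> _ [S dsS <-]; rewrite -[S]mxvecK; apply: vmin.
  by rewrite inE /K /= mxvecK.
have -> : delta_ds B B0 = ds_cost B B0 (vec_mx v).
  apply/eqP; rewrite eq_le; apply/andP; split.
    by apply: ge_inf; [exists (ds_cost B B0 (vec_mx v))|exists (vec_mx v)].
  by apply: lb_le_inf => //; exists (ds_cost B B0 1%:M), 1%:M.
split; first by exists (vec_mx v).
by move=> S dsS; apply: vlb; exists S.
Qed.

End Distances.

(* Main.v *)
Require Import Defs.
From mathcomp Require Import all_boot all_order all_algebra.
From mathcomp Require Import all_reals.
From mathcomp Require Import perm zify.

Import Order.TTheory GRing.Theory Num.Theory.
Local Open Scope ring_scope.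

(** If [S] is doubly stochastic, the bipartite graph of the entries of [S] that
    are at least [1/k^2] satisfies Hall's condition: were [A] a set of columns
    with fewer than [#|A|] neighbouring rows, at most [#|A| - 1] of the mass
    [#|A|] of these columns would lie in these rows, and less than [1] outside,
    in at most [k^2] entries, each less than [1/k^2]. So there is a
    permutation [s] with [S (s i) i >= 1/k^2] for all [i], and the terms
    [(a, a', b, b') = (s i, i, s j, j)] of the doubly stochastic cost alone are
    at least [1/k^4] times the cost of [s]. *)

(* Rado's proof: a family with a set [N x] of at least two elements can be
   shrunk, for otherwise removing either of two elements of [N x] creates a
   violating set, and the two violating sets contradict submodularity. *)
Lemma hall_marriage (T U : finType) (N : T -> {set U}) :
    (forall A : {set T}, #|A| <= #|\bigcup_(x in A) N x|)%N ->
  exists2 f : T -> U, injective f & forall x, f x \in N x.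
Proof.
have [n] := ubnP (\sum_x #|N x|)%N; elim: n N => // n IHn N leN hallN.
have [N1|] := boolP [forall x, #|N x| <= 1]%N.
  have /fin_all_exists[f fE] x : exists y, N x = [set y].
    have /cards1P[y ->] : #|N x| == 1%N; last by exists y.
    rewrite eqn_leq (forallP N1) /=.
    by have := hallN [set x]; rewrite big_set1 cards1.
  exists f => [x y exy|x]; last by rewrite fE set11.
  apply/eqP/negPn/negP => xy.
  (* Two equal singletons would leave a pair with a single neighbour. *)
  have := hallN [set x; y]; rewrite cards2 xy big_setU1 ?inE //= big_set1.
  by rewrite !fE exy setUid cards1.
rewrite negb_forall => /existsP[x]; rewrite -ltnNge => /card_gt1P[y1 [y2 [y1N y2N y12]]].
pose M y z := if z == x then N x :\ y else N z.
have shrink y z : M y z \subset N z.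
  by rewrite /M; case: eqP => [->|_] //; apply: subD1set.
have reduce y : y \in N x ->
    (forall A : {set T}, #|A| <= #|\bigcup_(z in A) M y z|)%N ->
    exists2 f : T -> U, injective f & forall z, f z \in N z.
  move=> yN hallM; have [|f finj fM] := IHn (M y) _ hallM; last first.
    by exists f => // z; apply: (subsetP (shrink y z)).
  rewrite -ltnS; apply: leq_trans leN; rewrite ltnS.
  rewrite (bigD1 x) //= [ltnRHS](bigD1 x) //= -addSn leq_add //.
    by rewrite /M eqxx [ltnRHS](cardsD1 y) yN.
  by apply: leq_sum => z _; apply: subset_leq_card.
have violator y : (exists2 f : T -> U, injective f & forall z, f z \in N z) \/
    exists2 A : {set T}, x \in A & (y \in N x -> #|\bigcup_(z in A) M y z| < #|A|)%N.
  have [yN|yN] := boolP (y \in N x); last by right; exists [set x]; rewrite ?set11.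
  have [/forallP/(reduce _ yN)|] :=
    boolP [forall A : {set T}, #|A| <= #|\bigcup_(z in A) M y z|]%N.
    by left.
  rewrite negb_forall => /existsP[A]; rewrite -ltnNge => ltA.
  (* A violating set must contain [x]: on any other set [M y] agrees with [N]. *)
  right; exists A => //; apply: contraLR ltA => xA; rewrite -leqNgt.
  rewrite (eq_bigr N) ?hallN // => z zA.
  by rewrite /M; case: eqP zA xA => // -> ->.
have [//|[A1 xA1 /(_ y1N) lt1]] := violator y1.
have [//|[A2 xA2 /(_ y2N) lt2]] := violator y2.
set V1 := \bigcup_(z in A1) _ in lt1; set V2 := \bigcup_(z in A2) _ in lt2.
have memV y (A : {set T}) z u : z \in A -> u \in N z -> (z == x) ==> (u != y) ->
    u \in \bigcup_(z in A) M y z.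
  move=> zA uN zx; apply/bigcupP; exists z => //; rewrite /M.
  by case: eqP zx uN => [->|//] /= uy uN; rewrite !inE uy.
(* Only [y1], resp. [y2], is removed from [N x]; as they differ and [x] lies in both [A1] and [A2],
   the other union still covers it. *)
have leU : (#|A1 :|: A2| <= #|V1 :|: V2|)%N.
  apply: leq_trans (hallN _) (subset_leq_card _); apply/bigcupsP => z zA.
  apply/subsetP => u uN; rewrite inE.
  have [zx|zx] := eqVneq z x.
    rewrite zx in uN; have [uy|uy] := eqVneq u y1.
      by apply/orP; right; apply: (memV _ _ x); rewrite // uy y12 implybT.
    by apply/orP; left; apply: (memV _ _ x); rewrite // uy implybT.
  move: zA; rewrite inE => /orP[] zA; apply/orP; [left|right];
    by apply: (memV _ _ z); rewrite // (negPf zx).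
(* Away from [x] nothing was removed. *)
have leI : (#|(A1 :&: A2) :\ x| <= #|V1 :&: V2|)%N.
  apply: leq_trans (hallN _) (subset_leq_card _); apply/bigcupsP => z.
  rewrite !inE => /and3P[zx zA1 zA2]; apply/subsetP => u uN; rewrite inE.
  by apply/andP; split; apply: (memV _ _ z); rewrite // (negPf zx).
(* Adding [leU] and [leI] gives |V1| + |V2| >= |A1| + |A2| - 1, whereas [lt1] and [lt2] give at most
   |A1| + |A2| - 2. *)
have := cardsD1 x (A1 :&: A2); rewrite inE xA1 xA2 /=.
have := cardsUI A1 A2; have := cardsUI V1 V2; lia.
Qed.

Lemma doubly_stochastic_large_diagonal (R : realType) (k : nat) (S : 'M[R]_k) :
  doubly_stochastic S -> exists s : 'S_k, forall i, (k%:R ^+ 2)^-1 <= S (s i) i.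
Proof.
case=> S0 Srow Scol; set e := (k%:R ^+ 2)^-1.
have [|f finj fN] := @hall_marriage _ _ (fun j => [set i | e <= S i j]).
  move=> A; set V := \bigcup_(j in A) _; rewrite leqNgt; apply/negP => ltVA.
  have k0 : (0 < k)%N.
    by rewrite -[k]card_ord (leq_trans _ (max_card (mem A))) // (leq_ltn_trans _ ltVA).
  have : (#|A|%:R : R) < #|V|%:R + 1.
    have -> : (#|A|%:R : R) = \sum_i \sum_(j in A) S i j.
      by rewrite exchange_big /= (eq_bigr (fun=> 1)) // sumr_const.
    rewrite (bigID (mem V)) /= ler_ltD //.
      rewrite -sumr_const; apply: ler_sum => i _.
      rewrite -(Srow i) [leRHS](bigID (mem A)) /= lerDl.
      by apply: sumr_ge0.
    (* Comparing the small entries with [e] is strict only over a nonempty range, hence the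
       witnesses [i0] and [j0]. *)
    have [i0 i0V] : exists i0, i0 \notin V.
      apply/existsP; rewrite -negb_forall; apply/negP => /forallP VT.
      move: ltVA; rewrite ltnNge (_ : V = setT) ?cardsT ?max_card //.
      by apply/setP => i; rewrite VT inE.
    have [j0 j0A] : exists j0, j0 \in A.
      by apply/card_gt0P; rewrite (leq_ltn_trans _ ltVA).
    have small i j : i \notin V -> j \in A -> S i j < e.
      move=> iV jA; rewrite ltNge; apply: contra iV => Sij.
      by apply/bigcupP; exists j; rewrite ?inE.
    apply: (@lt_le_trans _ _ (\sum_(i | i \notin V) \sum_(j in A) e)).
      apply: ltr_sum; first by apply/hasP; exists i0; rewrite ?mem_index_enum.
      move=> i iV; apply: ltr_sum; last by move=> j; apply: small.
      by apply/hasP; exists j0; rewrite ?mem_index_enum.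
    under eq_bigl do rewrite -in_setC.
    rewrite !sumr_const -mulrnA -mulr_natr ler_pdivrMl ?exprn_gt0 ?ltr0n //.
    rewrite mulr1 -natrX ler_nat -mulnn leq_mul //.
      by rewrite -[leqRHS]card_ord max_card.
    by rewrite -[leqRHS]card_ord max_card.
  by rewrite natr1 ltr_nat ltnS leqNgt ltVA.
by exists (perm finj) => i; rewrite permE; have := fN i; rewrite inE.
Qed.

Lemma perm_cost_le_ds_cost (R : realType) (k : nat) (B B0 S : 'M[R]_k)
    (s : 'S_k) (e : R) :
    0 <= e -> (forall i j, 0 <= S i j) -> (forall i, e <= S (s i) i) ->
  e ^+ 2 * perm_cost B B0 s <= ds_cost B B0 S.
Proof.
move=> e0 S0 eS; rewrite /perm_cost /ds_cost mulrCA.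
(* With the sum over [a'] outermost, each [a' = i] keeps only its term [a = s i]; likewise below for
   [b'] and [b]. *)
rewrite ler_wpM2l ?invr_ge0 ?exprn_ge0 // [leRHS]exchange_big mulr_sumr /=.
have term_ge0 a a' b b' : 0 <= (B a b - B0 a' b') ^+ 2 * S a a' * S b b'.
  by rewrite mulr_ge0 // mulr_ge0 // sqr_ge0.
apply: ler_sum => i _; rewrite [leRHS](bigD1 (s i)) //=.
apply: ler_wpDr; first by do 3!apply: sumr_ge0 => ? _.
rewrite [leRHS]exchange_big mulr_sumr /=.
apply: ler_sum => j _; rewrite [leRHS](bigD1 (s j)) //=.
apply: ler_wpDr; first by apply: sumr_ge0.
by rewrite mulrC -mulrA ler_wpM2l ?sqr_ge0 // expr2 ler_pM.
Qed.

Theorem theoremE1 (R : realType) (k : nat) (hk : (0 < k)%N) (B B0 : 'M[R]_k)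
    (Bsym : B^T = B) (B0sym : B0^T = B0)
    (Bge0 : forall i j, 0 <= B i j) (B0ge0 : forall i j, 0 <= B0 i j) :
  delta_p B B0 <= k%:R ^+ 4 * delta_ds B B0.
Proof.
have [[S dsS ->] _] := delta_ds_min B B0.
have [s sS] := doubly_stochastic_large_diagonal _ _ _ dsS.
apply: le_trans ((delta_p_min B B0).2 s) _.
have k4 : 0 < (k%:R ^+ 4 : R) by rewrite exprn_gt0 // ltr0n.
(* The inverse of k^4 is the square of the threshold 1/k^2 that bounds the diagonal of [S] along
   [s]. *)
rewrite mulrC -ler_pdivrMr // mulrC (_ : _^-1 = (k%:R ^+ 2)^-1 ^+ 2).
  by apply: perm_cost_le_ds_cost => //; [rewrite invr_ge0 exprn_ge0|case: dsS].
by rewrite exprVn -exprM.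
Qed.
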